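(* Let $\mathbf u$ be a recurrent aperiodic infinite word over a finite alphabet, and suppose that its language is closed under reversal. Then, for each integer $n\ge 0$ satisfying $$p_{\mathbf u}(n)\le \tfrac32 n+1,$$ one has $$\operatorname{Pal}_{\mathbf u}(n)+\operatorname{Pal}_{\mathbf u}(n+1)=p_{\mathbf u}(n+1)-p_{\mathbf u}(n)+2.$$ The coefficient $3/2$ is optimal: for every real $c>3/2$, there exist an integer $n\ge 0$ and a binary (that is, two-letter) uniformly recurrent aperiodic infinite word $\mathbf v$ with reversal-closed language such that $$p_{\mathbf v}(n)\le cn+1\qquad\text{and}\qquad \operatorname{Pal}_{\mathbf v}(n)+\operatorname{Pal}_{\mathbf v}(n+1)<p_{\mathbf v}(n+1)-p_{\mathbf v}(n)+2.$$
   Context: Infinite words are one-sided sequences of letters. A factor of an infinite word is a contiguous finite block of it (including the empty word $\varepsilon$, of length $0$); the language of $\mathbf u$ is its set $\mathcal L(\mathbf u)$ of factors. For a finite word $w=w_1\cdots w_r$, its reversal is $\overline w=w_r\cdots w_1$; $w$ is a palindrome if $w=\overline w$ (the empty word is a palindrome). The language is closed under reversal if $w\in\mathcal L(\mathbf u)$ implies $\overline w\in\mathcal L(\mathbf u)$. $p_{\mathbf u}(n)$ is the number of distinct factors of $\mathbf u$ of length $n$, and $\operatorname{Pal}_{\mathbf u}(n)$ is the number of distinct palindromic factors of $\mathbf u$ of length $n$; thus $p_{\mathbf u}(0)=\operatorname{Pal}_{\mathbf u}(0)=1$. The word $\mathbf u$ is recurrent if every factor occurs infinitely often in it, and uniformly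 recurrent if the gaps between successive occurrences of each factor are bounded. It is eventually periodic if it has the form $xyyy\cdots$ for finite words $x$ and nonempty $y$, and aperiodic otherwise. *)

(* Defs.v *)
From mathcomp Require Import all_boot boolp.

Set Implicit Arguments.
Unset Strict Implicit.
Unset Printing Implicit Defensive.

Section InfiniteWords.
Variable A : finType.
Implicit Types (u : nat -> A) (w : seq A).

Definition occurs_at u w (i : nat) : Prop :=
  w = mkseq (fun k => u (i + k)) (size w).

Definition factor u w : Prop := exists i, occurs_at u w i.

Definition reversal_closed u : Prop :=
  forall w, factor u w -> factor u (rev w).

Definition palindrome w : bool := w == rev w.

Definition factor_complexity u (n : nat) : nat :=
  #|[set w : n.-tuple A | `[< factor u w >]]|.

Definition palindromic_complexity u (n : nat) : nat :=
  #|[set w : n.-tuple A | `[< factor u w >] && palindrome w]|.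

Definition recurrent u : Prop :=
  forall w, factor u w -> forall N, exists i, N <= i /\ occurs_at u w i.

Definition successive_occurrences u w (i j : nat) : Prop :=
  [/\ i < j, occurs_at u w i, occurs_at u w j
    & forall k, i < k < j -> ~ occurs_at u w k].

(* Recurrence is required explicitly: a factor with finitely many occurrences
   would satisfy the bound on gaps vacuously after its last occurrence. *)
Definition uniformly_recurrent u : Prop :=
  recurrent u /\
  forall w, factor u w ->
    exists G, forall i j, successive_occurrences u w i j -> j - i <= G.

(* u = x y y y ...; the default u 0 of nth is never reached. *)
Definition eventually_periodic u : Prop :=
  exists x y : seq A, y <> [::] /\
    forall n, u n = if n < size x then nth (u 0) x n
                    else nth (u 0) y ((n - size x) %% size y).

Definition aperiodic u : Prop := ~ eventually_periodic u.

End InfiniteWords.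

(* Main.v *)
Require Import Defs.
From mathcomp Require Import all_boot all_order all_algebra.
From mathcomp Require Import boolp reals zify ring lra.
Import Order.TTheory GRing.Theory Num.Theory.

Set Implicit Arguments.
Unset Strict Implicit.
Unset Printing Implicit Defensive.

(** Write p and P for the factor and palindromic complexities and put
    T(n) = p(n+1) - p(n) + 2 - P(n) - P(n+1).  The word is called deficient
    at n when T(n) > 0; the claim is that T(n) = 0 whenever p(n) <= 3n/2 + 1.

    Identify every factor with its reversal.  The classes of factors of length
    n are the vertices of a connected graph whose edges are the classes of
    non-palindromic factors of length n+1; there are (p(n) + P(n))/2 vertices
    and (p(n+1) - P(n+1))/2 edges, so T(n) is twice the first Betti number of
    this graph.  Hence T(n) >= 0 (deficit_ge0), T(n) is even, and T(n) > 0
    exactly when the graph has a cycle.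

    Upper bound on the order.  It is shown by induction on n that T(n) > 0
    forces 2 p(n) >= 3n + 3 (deficient_complexity).  There are three ways to
    be deficient at n+1.
    - T(n+1) > T(n).  Comparing extensions letter by letter (deficit_step),
      some factor w of length n is either a non-palindromic bispecial factor
      or a palindrome with three right extensions.  In the second case every
      suffix of w has three right extensions and p grows by at least 2 at each
      step.  In the first case w and its reversal are both right special, and
      their suffixes of length j can agree only when 2j <= n - 2, otherwise w
      would be a palindrome; so p grows by at least 2 at each j >= (n - 1)/2
      and by at least 1 before (nonpal_bispecial_complexity).
    - T(n) > 0 and p(n+1) >= p(n) + 2: the induction hypothesis suffices.
    - T(n) > 0 and p(n+1) = p(n) + 1.  There is a single right special factor
      r, with two extensions, and a single left special one, its reversal l.
      Reversal acts on the two paths that leave r and stop at l.  If both are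
      fixed, their centres are two palindromes and T(n) = 0; if they are
      swapped they have equal length and equal ends, which forces a length of
      at least n + 2, hence p(n) >= 2n + 2 (single_branch_dichotomy).

    Optimality.  In a word whose runs of zeros have lengths 2h, 2h+1 and 2h+2,
    separated by single ones, the factor w = 0^(2h+1) 1 0^(2h) is not a
    palindrome.  If it has all four two-sided extensions, these are four edges
    forming a cycle of the graph, and T(4h+3) > 0
    (strong_bispecial_deficient).  A window of length 4h+3 containing at most
    two ones is determined by the place of the first one and the following
    gap, so p(4h+3) <= 3(2h+3), which is asymptotic to 3/2 times 4h+3.
    Substituting two palindromic blocks of equal length into the period
    doubling word produces a word of this kind that is aperiodic, uniformly
    recurrent and closed under reversal. *)
(** * Classes counted at their first visit *)

Section Orbits.
Variables (X : finType) (f : nat -> X) (s : X -> X).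
Hypothesis sK : involutive s.

(** The orbit of f i under the involution s is visited at time i for the first
    time; such times are in bijection with the visited orbits. *)
Definition fresh (i : nat) : bool :=
  [forall j : 'I_i, (f j != f i) && (f j != s (f i))].

Definition met (N : nat) : {set X} :=
  [set x | [exists j : 'I_N, (f j == x) || (f j == s x)]].

Lemma freshP i :
  reflect (forall j, j < i -> f j <> f i /\ f j <> s (f i)) (fresh i).
Proof.
apply: (iffP forallP) => [H j ji | H j].
  by have /andP[/eqP ? /eqP] := H (Ordinal ji).
by have [/eqP-> /eqP->] := H j (ltn_ord j).
Qed.

Lemma metP N x :
  reflect (exists2 j, j < N & f j = x \/ f j = s x) (x \in met N).
Proof.
rewrite inE; apply: (iffP existsP) => [[j /orP[]/eqP ?]|[j jN fj]].
- by exists j => //; left.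
- by exists j => //; right.
- by exists (Ordinal jN); case: fj => /= ->; rewrite eqxx ?orbT.
Qed.

Lemma met_recr N :
  met N.+1 = if fresh N then f N |: (s (f N) |: met N) else met N.
Proof.
apply/setP => x; apply/metP/idP => [[j jN fj]|].
  have [jN'|Nj] := ltnP j N.
    have xM : x \in met N by apply/metP; exists j.
    by case: ifP => // _; rewrite !in_setU1 xM !orbT.
  have {jN Nj} jN : j = N by lia.
  subst j.
  case: ifPn => [_|/freshP nfr].
    by rewrite !in_setU1; case: fj => ->; rewrite ?sK eqxx ?orbT.
  apply: contra_notT nfr => xM j jN; split=> E; case: (negP xM); apply/metP;
    exists j => //; rewrite E; case: fj => ->; rewrite ?sK; tauto.
case: ifP => _; rewrite ?in_setU1; last first.
  by move=> /metP[j jN fj]; exists j => //; lia.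
case/or3P => [/eqP->|/eqP->|/metP[j jN fj]]; [exists N|exists N|exists j] => //.
- by left.
- by right; rewrite sK.
- by lia.
Qed.

Lemma fresh_notin i : fresh i -> f i \notin met i /\ s (f i) \notin met i.
Proof.
move=> /freshP fr; split; apply/metP => -[j ji];
 have := fr j ji; rewrite ?sK; tauto.
Qed.

(** A new orbit contributes two points, unless it is a fixed point: so orbits
    are counted by half the number of points plus half the number of fixed
    points, and the free orbits by half the difference. *)
Lemma sum_fresh N :
  2 * \sum_(i < N) fresh i = #|met N| + #|[set x in met N | s x == x]| /\
  2 * \sum_(i < N) (fresh i && (s (f i) != f i))
    + #|[set x in met N | s x == x]| = #|met N|.
Proof.
elim: N => [|N [IH1 IH2]].
  rewrite !big_ord0.
  have ->: met 0 = set0 by apply/setP => x; rewrite [RHS]inE; apply/metP => -[].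
  have ->: [set x in set0 | s x == x] = set0 by apply/setP => x; rewrite !inE.
  by rewrite cards0.
rewrite !big_ord_recr /= !mulnDr IH1 met_recr.
case: ifP => [fr|_] /=; last by rewrite !muln0 !addn0.
have [n1 n2] := fresh_notin fr.
have [E|E] := eqVneq (s (f N)) (f N) => /=.
  rewrite E setUA setUid cardsU1 n1.
  have ->: [set x in f N |: met N | s x == x]
         = f N |: [set x in met N | s x == x].
    by apply/setP => x; rewrite !in_set !in_set1; case: eqP => [->|] //=; rewrite E eqxx.
  rewrite cardsU1 inE (negbTE n1) /= -IH2; split; ring.
have ->: [set x in f N |: (s (f N) |: met N) | s x == x]
        = [set x in met N | s x == x].
  apply/setP => x; rewrite !in_set !in_set1; case: (x =P f N) => [->|] /=.
    by rewrite (negbTE E) andbF.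
  by case: (x =P s (f N)) => [->|] //= _; rewrite sK eq_sym (negbTE E) andbF.
rewrite cardsU1 in_setU1 eq_sym (negbTE E) (negbTE n1).
by rewrite cardsU1 (negbTE n2) /= -IH2; split; ring.
Qed.

End Orbits.

(** * Windows, languages and the deficit *)

Section Windows.
Variables (A : finType) (u : nat -> A).
Implicit Types (w : seq A) (n i j k : nat).

Definition window n i : n.-tuple A := [tuple of mkseq (fun k => u (i + k)) n].

Definition lang n : {set n.-tuple A} := [set w : n.-tuple A | `[< factor u w >]].

Definition rev_tup n (w : n.-tuple A) : n.-tuple A := [tuple of rev w].

Lemma rev_tupK n : involutive (@rev_tup n).
Proof. by move=> w; apply: val_inj; rewrite /= revK. Qed.

Lemma occurs_window n i : occurs_at u (window n i) i.
Proof. by rewrite /occurs_at size_tuple. Qed.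

Lemma occursP w i :
  occurs_at u w i <-> forall k, k < size w -> nth (u 0) w k = u (i + k).
Proof.
split=> [E k kn|H]; first by rewrite E nth_mkseq.
apply: (@eq_from_nth _ (u 0)); first by rewrite size_mkseq.
by move=> k kn; rewrite nth_mkseq // H.
Qed.

Lemma langP n (w : n.-tuple A) : reflect (exists i, w = window n i) (w \in lang n).
Proof.
rewrite inE; apply: (iffP (asboolP _)) => -[i].
  by rewrite /occurs_at size_tuple => E; exists i; apply: val_inj.
by move=> ->; exists i; apply: occurs_window.
Qed.

Lemma window_lang n i : window n i \in lang n.
Proof. by apply/langP; exists i. Qed.

Lemma nth_window n i k : k < n -> nth (u 0) (window n i) k = u (i + k).
Proof. exact: nth_mkseq. Qed.

Lemma window_eqP n i j :
  reflect (forall k, k < n -> u (i + k) = u (j + k)) (window n i == window n j).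
Proof.
apply: (iffP eqP) => [E k kn|H].
  by rewrite -(nth_window i kn) E nth_window.
apply/val_inj/(@eq_from_nth _ (u 0)); rewrite !size_tuple // => k kn.
by rewrite !nth_window // H.
Qed.

(** Reversal in terms of positions only, so that later arguments about
    overlapping windows become index arithmetic. *)
Lemma window_revP n i j :
  reflect (forall k, k < n -> u (i + k) = u (j + (n - k.+1)))
          (window n i == rev_tup (window n j)).
Proof.
have rn k : k < n ->
    nth (u 0) (rev_tup (window n j)) k = u (j + (n - k.+1)).
  move=> kn; rewrite nth_rev size_tuple // nth_window //; lia.
apply: (iffP eqP) => [E k kn|H].
  by rewrite -(nth_window i kn) E rn.
apply/val_inj/(@eq_from_nth _ (u 0)); rewrite !size_tuple // => k kn.
by rewrite rn // nth_window // H.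
Qed.

Lemma window_take n i : val (window n i) = take n (window n.+1 i).
Proof.
apply: (@eq_from_nth _ (u 0)); rewrite ?size_takel ?size_tuple // => k kn.
by rewrite nth_take // !nth_window //; lia.
Qed.

Lemma window_behead n i : val (window n i.+1) = behead (window n.+1 i).
Proof.
apply: (@eq_from_nth _ (u 0)); rewrite ?size_behead ?size_tuple // => k kn.
by rewrite nth_behead !nth_window //; congr u; lia.
Qed.

(** A finite prefix of the word already shows all its factors of length n.
    The bound is stable under enlarging m, so that two lengths can share one. *)
Lemma lang_bounded n :
  exists N, forall m, N <= m -> forall w : n.-tuple A, w \in lang n ->
    exists2 i, i < m & w = window n i.
Proof.
have /fin_all_exists[f Hf] (w : n.-tuple A) :
    exists i, w \in lang n -> w = window n i.
  have [/langP[i ->]|] := boolP (w \in lang n); first by exists i.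
  by exists 0.
exists (\max_w f w).+1 => m Nm w wL; exists (f w); last exact: Hf.
by apply: leq_trans Nm; rewrite ltnS; apply: leq_bigmax.
Qed.

Lemma pal_complexity_lang n :
  palindromic_complexity u n = #|[set w in lang n | rev_tup w == w]|.
Proof.
apply: eq_card => w; rewrite !inE /palindrome; congr (_ && _).
by rewrite eq_sym -val_eqE.
Qed.

Lemma pal_complexity_gt0 m i :
  rev_tup (window m i) = window m i -> 0 < palindromic_complexity u m.
Proof.
move=> E; rewrite pal_complexity_lang; apply/card_gt0P; exists (window m i).
by rewrite inE window_lang E /=.
Qed.

Lemma pal_complexity_gt1 m i j :
  rev_tup (window m i) = window m i -> rev_tup (window m j) = window m j ->
  window m i <> window m j -> 1 < palindromic_complexity u m.
Proof.
move=> Ei Ej ne; rewrite pal_complexity_lang; apply/card_gt1P.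
exists (window m i), (window m j).
by split; [rewrite inE window_lang Ei /=|rewrite inE window_lang Ej /=|apply/eqP].
Qed.

(** The condition T(n) > 0, written without subtraction. *)
Definition deficient n : Prop :=
  factor_complexity u n + palindromic_complexity u n + palindromic_complexity u n.+1
    < factor_complexity u n.+1 + 2.

Hypothesis rcu : reversal_closed u.

Lemma rev_lang n (w : n.-tuple A) : (rev_tup w \in lang n) = (w \in lang n).
Proof.
have H (x : n.-tuple A) : x \in lang n -> rev_tup x \in lang n.
  by rewrite !inE => /asboolP xL; apply/asboolP/rcu.
by apply/idP/idP => /H //; rewrite rev_tupK.
Qed.

(** The vertices of the graph modulo reversal are the times at which a window
    is fresh, its edges the times at which a non-palindromic one is. *)
Lemma card_lang_fresh n :
  exists N, forall m, N <= m ->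
    2 * \sum_(i < m) fresh (window n) (@rev_tup n) i
      = factor_complexity u n + palindromic_complexity u n /\
    2 * \sum_(i < m) (fresh (window n) (@rev_tup n) i
                      && (rev_tup (window n i) != window n i))
      + palindromic_complexity u n = factor_complexity u n.
Proof.
have [N HN] := lang_bounded n; exists N => m Nm.
have metE : met (window n) (@rev_tup n) m = lang n.
  apply/setP => w; apply/metP/idP.
    by move=> [j _ [E|E]]; rewrite ?[w \in _]E -?E -?[w \in _]rev_lang -?E window_lang.
  by move=> /(HN _ Nm)[i im ->]; exists i => //; left.
rewrite pal_complexity_lang -metE; have := sum_fresh (window n) (@rev_tupK n) m.
by rewrite metE.
Qed.

(** Reading the word explores the graph: the edge by which a vertex is entered
    for the first time joins it to an older vertex, so this edge is itself new,
    and it is not a loop.  This is connectedness in the form of an injection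
    from the vertices, but the first, into the edges. *)
Lemma fresh_edge n i :
  fresh (window n) (@rev_tup n) i.+1 ->
  fresh (window n.+1) (@rev_tup n.+1) i
    && (rev_tup (window n.+1 i) != window n.+1 i).
Proof.
move=> /freshP fr.
have noeq j : j < i.+1 -> window n.+1 j != rev_tup (window n.+1 i).
  move=> ji; apply/negP => /window_revP H; have [_ []] := fr j ji.
  apply/eqP/window_revP => k kn; rewrite H; last lia.
  congr u; lia.
apply/andP; split; last by rewrite eq_sym noeq.
apply/freshP => j ji; split; last by apply/eqP/noeq; lia.
move=> /eqP/window_eqP H; have [|[]] := fr j.+1; first lia.
by apply/eqP/window_eqP => k kn; rewrite !addSnnS H.
Qed.

Lemma deficit_ge0 n :
  factor_complexity u n + palindromic_complexity u n
    + palindromic_complexity u n.+1 <= factor_complexity u n.+1 + 2.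
Proof.
have [N HN] := card_lang_fresh n; have [N' HN'] := card_lang_fresh n.+1.
have [|<- _] := HN (maxn N N').+1; first lia.
have [|_ <-] := HN' (maxn N N'); first lia.
rewrite big_ord_recl.
have : \sum_(i < maxn N N') fresh (window n) (@rev_tup n) (bump 0 i) <=
   \sum_(i < maxn N N') (fresh (window n.+1) (@rev_tup n.+1) i
      && (rev_tup (window n.+1 i) != window n.+1 i)).
  apply: leq_sum => i _; rewrite /bump add1n.
  by case: (boolP (fresh _ _ _)) => // /fresh_edge->.
by case: (fresh _ _ _) => /=; lia.
Qed.

(** A new edge leading to an old vertex closes a cycle. *)
Lemma deficit_gt0 n i :
  fresh (window n.+1) (@rev_tup n.+1) i ->
  rev_tup (window n.+1 i) != window n.+1 i ->
  ~~ fresh (window n) (@rev_tup n) i.+1 ->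
  factor_complexity u n + palindromic_complexity u n
    + palindromic_complexity u n.+1 <= factor_complexity u n.+1.
Proof.
move=> fi ni vi.
have [N HN] := card_lang_fresh n; have [N' HN'] := card_lang_fresh n.+1.
pose m := maxn i.+1 (maxn N N').
have [|<- _] := HN m.+1; first lia.
have [|_ <-] := HN' m; first lia.
have im : i < m by lia.
rewrite big_ord_recl.
(* The inequality between the sums is strict at the index i. *)
have : \sum_(i < m) fresh (window n) (@rev_tup n) (bump 0 i) <
   \sum_(i < m) (fresh (window n.+1) (@rev_tup n.+1) i
      && (rev_tup (window n.+1 i) != window n.+1 i)).
  rewrite (bigD1 (Ordinal im)) //= [X in _ < X](bigD1 (Ordinal im)) //=.
  rewrite /bump add1n (negbTE vi) fi ni ltnS.
  apply: leq_sum => j _; rewrite add1n.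
  by case: (boolP (fresh _ _ _)) => // /fresh_edge->.
by case: (fresh _ _ _) => /=; lia.
Qed.

(** Non-palindromic factors come in pairs, hence the deficit is even. *)
Lemma complexity_parity n :
  exists a b,
    factor_complexity u n + palindromic_complexity u n = 2 * a /\
    factor_complexity u n = palindromic_complexity u n + 2 * b.
Proof.
have [N HN] := card_lang_fresh n; have [<- E] := HN N (leqnn N).
by do 2 eexists; split; [reflexivity|rewrite -[LHS]E addnC].
Qed.

End Windows.

(** * Letter extensions of factors *)

Lemma card_dep_pairs (X Y : finType) (B : {set X}) (C : X -> {set Y}) :
  #|[set p : X * Y | (p.1 \in B) && (p.2 \in C p.1)]| = \sum_(x in B) #|C x|.
Proof.
rewrite -sum1dep_card.
under [RHS]eq_bigr do rewrite -sum1_card.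
by rewrite pair_big_dep.
Qed.

Section Extensions.
Variables (A : finType) (u : nat -> A).
Implicit Types (w x y : seq A) (a b : A) (n i j k : nat).

Definition rext w : {set A} := [set a | `[< factor u (rcons w a) >]].
Definition lext w : {set A} := [set a | `[< factor u (a :: w) >]].
Definition biext w : {set A * A} :=
  [set p | `[< factor u (p.1 :: rcons w p.2) >]].
Definition palext w : {set A} := [set a | `[< factor u (a :: rcons w a) >]].

Lemma occurs_cat x y i :
  occurs_at u (x ++ y) i <-> occurs_at u x i /\ occurs_at u y (i + size x).
Proof.
rewrite !occursP size_cat; split=> [H|[Hx Hy] k ks].
  split=> k ks; first by rewrite -H ?nth_cat ?ks //; lia.
  rewrite -addnA -H ?nth_cat; last lia.
  by rewrite ltnNge leq_addr addKn.
rewrite nth_cat; case: ltnP => kx; first exact: Hx.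
rewrite Hy; last lia.
congr u; lia.
Qed.

Lemma factor_catl x y : factor u (x ++ y) -> factor u x.
Proof. by case=> i /occurs_cat[]; exists i. Qed.

Lemma factor_catr x y : factor u (x ++ y) -> factor u y.
Proof. by case=> i /occurs_cat[_]; exists (i + size x). Qed.

Lemma factor_rcons w a : factor u (rcons w a) -> factor u w.
Proof. rewrite -cats1; exact: factor_catl. Qed.

Lemma factor_cons w a : factor u (a :: w) -> factor u w.
Proof. rewrite -cat1s; exact: factor_catr. Qed.

Lemma rext_suffix x y : rext (x ++ y) \subset rext y.
Proof.
apply/subsetP => a; rewrite !inE => /asboolP.
by rewrite rcons_cat => /factor_catr ?; apply/asboolP.
Qed.

Lemma rext_gt0 w : factor u w -> 0 < #|rext w|.
Proof.
move=> [i wi]; apply/card_gt0P; exists (u (i + size w)).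
rewrite inE; apply/asboolP; exists i.
rewrite -cats1; apply/occurs_cat; split=> //.
by rewrite /occurs_at /= /mkseq /= addn0.
Qed.

Lemma complexity_rext n :
  factor_complexity u n.+1 = \sum_(w in lang u n) #|rext w|.
Proof.
rewrite -card_dep_pairs; pose f (p : n.-tuple A * A) := [tuple of rcons p.1 p.2].
have f_inj : injective f.
  move=> [w a] [w' a'] /(congr1 val) /= /rcons_inj[ww' ->].
  by congr pair; apply: val_inj.
have [g _ fK] : bijective f.
  by apply: inj_card_bij f_inj _; rewrite card_prod !card_tuple expnSr.
rewrite -(card_imset _ f_inj); apply: eq_card => v; rewrite -(fK v).
rewrite (mem_imset _ _ f_inj) !inE /=; apply/idP/idP => [/asboolP H|/andP[]//].
by apply/andP; split; apply/asboolP => //; apply: factor_rcons H.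
Qed.

Definition around n (p : n.-tuple A * (A * A)) : n.+2.-tuple A :=
  [tuple of p.2.1 :: rcons p.1 p.2.2].

Lemma around_inj n : injective (@around n).
Proof.
move=> [w [a b]] [w' [a' b']] /(congr1 val) /= [-> /rcons_inj[ww' ->]].
by congr pair; apply: val_inj.
Qed.

Lemma aroundP n (v : n.+2.-tuple A) : exists p, v = around p.
Proof.
have [g _ fK] : bijective (@around n).
  by apply: inj_card_bij (@around_inj n) _; rewrite !card_prod !card_tuple !expnS; lia.
by exists (g v).
Qed.

Lemma rev_around n (w : n.-tuple A) (x y : A) :
  rev_tup (around (w, (x, y))) = around (rev_tup w, (y, x)).
Proof. by apply: val_inj; rewrite /= rev_cons rev_rcons. Qed.

Lemma window_around n i (w : n.-tuple A) (x y : A) : window u n.+2 i = around (w, (x, y)) ->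
  window u n.+1 i = [tuple of x :: w] /\ window u n.+1 i.+1 = [tuple of rcons w y].
Proof.
move=> E; split; apply: val_inj; last by rewrite window_behead E.
by rewrite window_take E /= -cats1 take_cat size_tuple ltnn subnn take0 cats0.
Qed.

Lemma biext_window n i : (u i, u (i.+1 + n)) \in biext (window u n i.+1).
Proof.
rewrite inE; apply/asboolP; exists i.
rewrite -cat1s -cats1; apply/occurs_cat; split.
  by rewrite /occurs_at /= /mkseq /= addn0.
apply/occurs_cat; rewrite addn1 size_tuple; split; first exact: occurs_window.
by rewrite /occurs_at /= /mkseq /= addn0.
Qed.

Lemma complexity_biext n :
  factor_complexity u n.+2 = \sum_(w in lang u n) #|biext w|.
Proof.
rewrite -card_dep_pairs -(card_imset _ (@around_inj n)); apply: eq_card => v.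
have [p ->] := aroundP v.
rewrite (mem_imset _ _ (@around_inj n)) !inE /=; apply/idP/idP => [/asboolP H|/andP[]//].
by apply/andP; split; apply/asboolP => //; apply: factor_rcons (factor_cons H).
Qed.

Lemma pal_complexity_palext n :
  palindromic_complexity u n.+2
    = \sum_(w in [set w in lang u n | rev_tup w == w]) #|palext w|.
Proof.
rewrite -card_dep_pairs.
pose f (p : n.-tuple A * A) := around (p.1, (p.2, p.2)).
have f_inj : injective f by move=> [w a] [w' a'] /around_inj[-> ->].
rewrite -(card_imset _ f_inj); apply: eq_card => v.
have [[w [a b]] ->] := aroundP v.
rewrite inE /palindrome /= rev_cons rev_rcons /=.
apply/andP/imsetP => [[/asboolP fv /eqP[/esym ba]]|].
  subst b => /rcons_inj[ww]; exists (w, a) => //.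
  rewrite !inE -val_eqE /= -ww eqxx andbT.
  by apply/andP; split; apply/asboolP => //; apply: factor_rcons (factor_cons fv).
move=> [[w' a']]; rewrite !inE /= => /andP[/andP[_ /eqP w'P]] fv.
move=> /around_inj[-> -> ->]; split => //.
by rewrite -[rev w']/(val (rev_tup w')) w'P.
Qed.

(** Every factor has at least one right extension, so each surplus extension of
    a single factor is a net gain. *)
Lemma complexity_growth n (w : n.-tuple A) : w \in lang u n ->
  factor_complexity u n + #|rext w| <= factor_complexity u n.+1 + 1.
Proof.
move=> wL; rewrite complexity_rext (bigD1 w) //=.
rewrite [factor_complexity u n](cardsD1 w) -/(lang u n) wL.
(* Arithmetic left once the other factors are charged one extension each. *)
have aux (i j k : nat) : i <= j -> true + i + k <= k + j + 1 by lia.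
apply: aux.
rewrite -[X in X <= _]sum1_card [X in X <= _](eq_bigl
  (fun i : n.-tuple A => (i \in lang u n) && (i != w))).
  by apply: leq_sum => v /andP[/[!inE]/asboolP/rext_gt0].
by move=> v; rewrite in_setD1 andbC.
Qed.

Lemma complexity_growth2 n (w w' : n.-tuple A) :
  w \in lang u n -> w' \in lang u n -> w != w' ->
  1 < #|rext w| -> 1 < #|rext w'| ->
  factor_complexity u n + 2 <= factor_complexity u n.+1.
Proof.
move=> wL w'L ww' rw rw'; rewrite complexity_rext (bigD1 w) //=.
rewrite (bigD1 w') /=; last by rewrite w'L eq_sym.
rewrite [factor_complexity u n](cardsD1 w) -/(lang u n) wL.
rewrite (cardsD1 w') in_setD1 eq_sym ww' w'L.
(* As above, with two factors set apart. *)
have aux (i j : nat) : i <= j -> true + (true && true + i) + 2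
    <= #|rext w| + (#|rext w'| + j) by move=> /=; lia.
apply: aux; rewrite -[X in X <= _]sum1_card [X in X <= _](eq_bigl
  (fun i : n.-tuple A => (i \in lang u n) && (i != w) && (i != w'))).
  by apply: leq_sum => v /andP[/andP[/[!inE]/asboolP/rext_gt0]].
by move=> v; rewrite !in_setD1 [RHS]andbC [_ && (v != w)]andbC.
Qed.

Hypothesis rcu : reversal_closed u.

Lemma card_lext n (w : n.-tuple A) : #|lext w| = #|rext (rev_tup w)|.
Proof.
apply: eq_card => a; rewrite !inE.
by apply/asboolP/asboolP => /rcu; rewrite ?rev_cons ?rev_rcons ?revK.
Qed.

Lemma complexity_lext n :
  factor_complexity u n.+1 = \sum_(w in lang u n) #|lext w|.
Proof.
rewrite complexity_rext (reindex_inj (can_inj (@rev_tupK A n))).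
by apply: eq_big => w; rewrite ?rev_lang // card_lext.
Qed.

Lemma biext_sub w : biext w \subset setX (lext w) (rext w).
Proof.
apply/subsetP => -[a b]; rewrite !inE /= => /asboolP H.
apply/andP; split; apply/asboolP; last exact: factor_cons H.
by move: H; rewrite -rcons_cons => /factor_rcons.
Qed.

(** When one side admits a single letter, a two-sided extension is determined
    by the letter on the other side. *)
Lemma biext_not_bispecial n (w : n.-tuple A) :
  w \in lang u n -> (#|rext w| <= 1) || (#|lext w| <= 1) ->
  #|biext w| + 1 <= #|lext w| + #|rext w|.
Proof.
move=> wL; have := subset_leq_card (biext_sub w); rewrite cardsX.
have : 0 < #|rext w| by apply: rext_gt0; move: wL; rewrite inE => /asboolP.
have : 0 < #|lext w|.
  rewrite card_lext; apply: rext_gt0.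
  by move: wL; rewrite -(rev_lang rcu) inE => /asboolP.
case: #|rext w| => [|[|r]]; case: #|lext w| => [|[|l]] //=; lia.
Qed.

(** The extensions by two distinct letters form a symmetric relation without
    diagonal on the right extensions; with k of these letters it has at most
    k(k - 1) elements, which is 2(k - 1) or less as soon as k <= 2. *)
Lemma biext_pal n (w : n.-tuple A) :
  w \in lang u n -> rev_tup w = w -> #|rext w| <= 2 ->
  #|biext w| + 2 <= #|lext w| + #|rext w| + #|palext w|.
Proof.
move=> wL wP r2; rewrite card_lext wP.
have lr : lext w = rext w.
  apply/setP => a; rewrite !inE -{2}wP /=.
  by apply/asboolP/asboolP => /rcu; rewrite ?rev_cons ?rev_rcons ?revK.
have : 0 < #|rext w| by apply: rext_gt0; move: wL; rewrite inE => /asboolP.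
(* The diagonal separates the palindromic extensions from the others. *)
pose D := [set (a, a) | a : A].
have : #|biext w :&: D| <= #|palext w|.
  have inj2 : injective (fun a : A => (a, a)) by move=> a b [].
  rewrite -(card_imset (palext w) inj2); apply: subset_leq_card.
  apply/subsetP => p /[!inE] /andP[pb /imsetP[a _ pE]].
  by apply/imsetP; exists a => //; rewrite inE; rewrite pE in pb.
have : #|biext w :\: D| + #|rext w| <= #|rext w| * #|rext w|.
  have inj2 : injective (fun a : A => (a, a)) by move=> a b [].
  rewrite -cardsX -[X in _ + X <= _](card_imset (rext w) inj2).
  have I0 : (biext w :\: D) :&: [set (a, a) | a in rext w] = set0.
    apply/setP => p; rewrite !inE; apply/negP => /andP[/andP[/negP pD _]].
    by move=> /imsetP[a _ pa]; apply: pD; apply/imsetP; exists a.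
  rewrite -cardsUI I0 cards0 addn0; apply/subset_leq_card/subsetP => p.
  case/setUP=> [/setDP[/(subsetP (biext_sub w))]|].
    by rewrite lr.
  by move=> /imsetP[a ar ->]; rewrite in_setX ar.
rewrite -(cardsID D (biext w)).
move: #|_ :\: _| #|_ :&: _| #|palext w| #|rext w| r2 => i j k.
by case=> [|[|[|r]]] //; lia.
Qed.

(** The conclusion says T(n+1) <= T(n).  Both sides are sums over the factors of
    length n, and the inequality holds term by term under these hypotheses. *)
Lemma deficit_step n :
  (forall w : n.-tuple A, w \in lang u n -> rev_tup w != w ->
     (#|rext w| <= 1) || (#|lext w| <= 1)) ->
  (forall w : n.-tuple A, w \in lang u n -> rev_tup w = w -> #|rext w| <= 2) ->
  factor_complexity u n.+2 + factor_complexity u n + palindromic_complexity u n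
    <= 2 * factor_complexity u n.+1 + palindromic_complexity u n.+2.
Proof.
move=> nonpal pal; rewrite mul2n -addnn {1}(complexity_lext n).
rewrite (complexity_rext n) (complexity_biext n) (pal_complexity_palext n).
have setE F : \sum_(w in [set w in lang u n | rev_tup w == w]) F w
    = \sum_(w in lang u n) (if rev_tup w == w then F w else 0).
  by rewrite -big_mkcondr; apply: eq_bigl => w; rewrite !inE.
rewrite [X in _ + X <= _](pal_complexity_lang u n) -sum1_card.
rewrite [factor_complexity u n]/factor_complexity -/(lang u n) -sum1_card.
rewrite !setE -!big_split /=; apply: leq_sum => w wL.
case: (eqVneq (rev_tup w) w) => E; last by rewrite !addn0 biext_not_bispecial ?nonpal.
by rewrite -[_ + 1 + _]addnA; apply: biext_pal wL E (pal w wL E).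
Qed.

End Extensions.

(** * Complexity forced by a new deficit *)

Section Growth.
Variables (A : finType) (u : nat -> A).
Implicit Types (n i j k : nat).

Lemma mem_rext_window n i a :
  reflect (exists2 j, window u n j = window u n i & u (j + n) = a)
          (a \in rext u (window u n i)).
Proof.
rewrite inE; apply: (iffP (asboolP _)) => -[j].
  rewrite -cats1 => /occurs_cat[]; rewrite !size_tuple => wj aj.
  exists j; last by move/(occursP u): aj => /(_ 0 isT) /=; rewrite addn0.
  by apply: val_inj; move: wj; rewrite /occurs_at size_tuple.
move=> <- <-; exists j; rewrite -cats1; apply/occurs_cat; rewrite size_tuple.
by split; [apply: occurs_window | rewrite /occurs_at /= /mkseq /= addn0].
Qed.

Lemma shift_multiples i q d m :
  (forall m, i <= m -> u (m + q) = u m) -> i <= m -> u (m + d * q) = u m.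
Proof.
by move=> H; elim: d => [|d IH] im; rewrite ?addn0 // mulSn addnCA addnC H ?IH //; lia.
Qed.

Lemma periodic_from i q :
  0 < q -> (forall m, i <= m -> u (m + q) = u m) -> eventually_periodic u.
Proof.
move=> q0 H; exists (mkseq u i), (mkseq (fun k => u (i + k)) q).
split; first by case: q q0 {H}.
move=> m; rewrite !size_mkseq; case: ltnP => im; first by rewrite nth_mkseq.
rewrite nth_mkseq ?ltn_mod //.
rewrite -(@shift_multiples i q ((m - i) %/ q) (i + _)) ?leq_addr //.
by congr u; have := divn_eq (m - i) q; lia.
Qed.

(** Otherwise each window determines the next one; two equal windows exist by
    the pigeonhole principle, and the word repeats from there on (Morse and
    Hedlund). *)
Lemma right_special_exists n :
  aperiodic u -> exists2 w : n.-tuple A, w \in lang u n & 1 < #|rext u w|.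
Proof.
move=> aper; apply: contrapT => none; apply: aper.
have det i j : window u n i = window u n j -> u (i + n) = u (j + n).
  move=> E; apply: contra_notP none => ne; exists (window u n i).
    exact: window_lang.
  apply/card_gt1P; exists (u (i + n)), (u (j + n)).
  by split; [apply/mem_rext_window; exists i | apply/mem_rext_window; exists j | apply/eqP].
have [i [j [ij Eij]]] : exists i j, i < j /\ window u n i = window u n j.
  pose f (x : 'I_#|{: n.-tuple A}|.+1) := window u n x.
  have /injectivePn[x [y xy fxy]] : ~~ injectiveb f.
    apply/negP => /injectiveP/leq_card; rewrite card_ord ltnn //.
  have [lt|gt|/val_inj E] := ltngtP x y; [exists x, y|exists y, x|] => //.
  by rewrite E eqxx in xy.
have shift k : window u n (i + k) = window u n (j + k).
  elim: k => [|k IH]; first by rewrite !addn0.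
  apply/eqP/window_eqP => l; rewrite leq_eqVlt => /orP[/eqP E|ln].
    by have := det _ _ IH; rewrite -E !addnS !addSn.
  by move/eqP/window_eqP: IH => /(_ l.+1 ln); rewrite !addnS !addSn.
apply: (@periodic_from (i + n) (j - i)) => [|m im]; first lia.
have := det _ _ (shift (m - n - i)).
have -> : i + (m - n - i) + n = m by lia.
by have -> : j + (m - n - i) + n = m + (j - i) by lia.
Qed.

Lemma complexity_increasing n :
  aperiodic u -> factor_complexity u n < factor_complexity u n.+1.
Proof.
move=> aper; have [w wL rw] := right_special_exists n aper.
have := complexity_growth wL; lia.
Qed.

Lemma complexity_gt n : aperiodic u -> n < factor_complexity u n.
Proof.
move=> aper; elim: n => [|n IH]; last first.
  exact: leq_ltn_trans IH (complexity_increasing n aper).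
apply/card_gt0P; exists (window u 0 0); exact: window_lang.
Qed.

Lemma lang_drop n (w : n.-tuple A) k :
  w \in lang u n -> [tuple of drop k w] \in lang u (n - k).
Proof.
rewrite !inE => /asboolP; rewrite -{1}(cat_take_drop k w) => /factor_catr H.
exact/asboolP.
Qed.

Lemma rext_drop (w : seq A) k : #|rext u w| <= #|rext u (drop k w)|.
Proof. by rewrite -{1}(cat_take_drop k w); apply/subset_leq_card/rext_suffix. Qed.

(** A common suffix of w and its reversal says that w has the same letter at i
    and at its mirror position; a suffix containing every letter beyond the
    middle says so for all i. *)
Lemma pal_of_common_suffix n (w : n.-tuple A) k :
  2 * k <= n.+1 -> drop k w = drop k (rev w) -> rev_tup w = w.
Proof.
move=> kn E; pose x0 := u 0.
have H i : k <= i < n -> nth x0 w i = nth x0 w (n - i.+1).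
  move=> /andP[ki i_n]; have := congr1 (fun s => nth x0 s (i - k)) E.
  by rewrite !nth_drop subnKC // nth_rev size_tuple.
apply/val_inj/(@eq_from_nth _ x0); rewrite !size_tuple // => i i_n.
rewrite nth_rev size_tuple //.
have [ki|ik] := leqP k i; first by rewrite (H i) ?ki.
have [kj|jk] := leqP k (n - i.+1).
  rewrite H; last lia.
  by congr (nth _ _ _); lia.
by congr (nth _ _ _); lia.
Qed.

Hypotheses (rcu : reversal_closed u) (aper : aperiodic u).

(** As long as the suffixes of w and of its reversal are distinct they are two
    right special factors.  They coincide only for lengths below (n - 1)/2, for
    which aperiodicity still provides one right special factor. *)
Lemma nonpal_bispecial_complexity n (w : n.-tuple A) :
  w \in lang u n -> rev_tup w != w -> 1 < #|rext u w| -> 1 < #|lext u w| ->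
  3 * n + 6 <= 2 * factor_complexity u n.+1.
Proof.
move=> wL wP rw lw.
have double k : 2 * k <= n.+1 ->
    factor_complexity u (n - k) + 2 <= factor_complexity u (n - k).+1.
  move=> kn.
  apply: (@complexity_growth2 _ _ _ [tuple of drop k w] [tuple of drop k (rev_tup w)]).
  - exact: lang_drop.
  - by apply: lang_drop; rewrite rev_lang.
  - apply: contra wP => /eqP/(congr1 val) /= E.
    by apply/eqP/(pal_of_common_suffix kn E).
  - exact: leq_trans rw (rext_drop _ _).
  - by rewrite (card_lext rcu) in lw; apply: leq_trans lw (rext_drop _ _).
(* Growth by 1 up to length n./2 and by 2 from there on. *)
suff H j : j <= n.+1 -> j + 1 + (j - n./2) <= factor_complexity u j.
  have := H n.+1 (leqnn _); lia.
elim: j => [|j IH] jn; first exact: complexity_gt.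
have [|nj] := leqP (n - j).*2 n.+1; last first.
  have := complexity_increasing j aper; lia.
rewrite -mul2n => /double; rewrite subKn //; lia.
Qed.

(** All suffixes of w keep its three right extensions. *)
Lemma branching3_complexity n (w : n.-tuple A) :
  w \in lang u n -> 2 < #|rext u w| ->
  3 * n + 6 <= 2 * factor_complexity u n.+1.
Proof.
move=> wL rw.
suff H j : j <= n.+1 -> 2 * j + 1 <= factor_complexity u j.
  have := H n.+1 (leqnn _); lia.
elim: j => [|j IH] jn; first exact: complexity_gt.
have := complexity_growth (lang_drop (n - j) wL).
have := rext_drop w (n - j); rewrite /= subKn //; lia.
Qed.

Lemma new_deficit_complexity n :
  2 * factor_complexity u n.+1 + palindromic_complexity u n.+2
    < factor_complexity u n.+2 + factor_complexity u n + palindromic_complexity u n ->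
  3 * n + 6 <= 2 * factor_complexity u n.+1.
Proof.
apply: contraTT; rewrite -leqNgt => small; apply: deficit_step => // w wL.
  move=> wP; apply: contraNT small; rewrite negb_or -!ltnNge => /andP[].
  exact: nonpal_bispecial_complexity.
move=> _; rewrite leqNgt; apply: contra small; exact: branching3_complexity.
Qed.

End Growth.

(** * Words with a single branching factor *)

Section SingleBranch.
Variables (A : finType) (u : nat -> A) (n : nat) (r : n.-tuple A).
Hypotheses (rcu : reversal_closed u) (rec : recurrent u) (n_gt0 : 0 < n).
Hypotheses (rL : r \in lang u n) (r2 : #|rext u r| = 2).
Hypothesis single : forall w : n.-tuple A, w \in lang u n -> w != r -> #|rext u w| <= 1.

(* Under these hypotheses the graph of windows of length n branches forwards
   only at r, and by reversal it branches backwards only at l. *)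
Local Notation W := (window u n).
Local Notation l := (rev_tup r).

Lemma step_forward i j : W i = W j -> W i <> r -> u (i + n) = u (j + n).
Proof.
move=> E ir; have /card_le1_eqP := single (window_lang u n i) (introN eqP ir).
by apply; apply/mem_rext_window; [exists j|exists i].
Qed.

Lemma window_shift i j : W i = W j -> u (i + n) = u (j + n) -> W i.+1 = W j.+1.
Proof.
move=> /eqP/window_eqP E En; apply/eqP/window_eqP => k; rewrite leq_eqVlt !addSnnS.
by case/orP => [/eqP->|] //; apply: E.
Qed.

Lemma step_backward i j : W i.+1 = W j.+1 -> W i.+1 <> l -> W i = W j.
Proof.
move=> E il; have rev_r : rev_tup (W i.+1) != r.
  by apply: contra_notN il => /eqP <-; rewrite rev_tupK.
have /card_le1_eqP one : #|lext u (W i.+1)| <= 1.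
  by rewrite (card_lext rcu); apply: single rev_r; rewrite rev_lang // window_lang.
have pre k : W k.+1 = W i.+1 -> u k \in lext u (W i.+1).
  move=> <-; rewrite inE; apply/asboolP; exists k; apply/(occursP u) => m.
  rewrite /= size_mkseq; case: m => [|m] mn /=; first by rewrite addn0.
  by rewrite nth_mkseq // addSnnS.
have uij : u i = u j by apply: one => //; apply: pre.
move/eqP/window_eqP: E => E; apply/eqP/window_eqP => -[|k] kn.
  by rewrite !addn0.
by rewrite -!addSnnS E //; lia.
Qed.

Lemma back_steps e i j :
  W (i + e) = W (j + e) -> (forall d, 0 < d <= e -> W (i + d) <> l) -> W i = W j.
Proof.
elim: e => [|e IH]; first by rewrite !addn0.
rewrite !addnS => E no_l; apply: IH => [|d de]; last by apply: no_l; lia.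
by apply: step_backward E _; rewrite -addnS; apply: no_l; lia.
Qed.

Lemma recurs (w : n.-tuple A) N : w \in lang u n -> exists2 m, N <= m & W m = w.
Proof.
rewrite inE => /asboolP/rec/(_ N)[m [Nm wm]]; exists m => //.
by apply: val_inj; move: wm; rewrite /occurs_at size_tuple.
Qed.

(** The stretch from i to i + d would be a loop without left special window.
    Such a loop can only be entered from itself, so every occurrence of r
    would be preceded by this loop all the way back to the origin, and l could
    not occur before r; recurrence forbids this. *)
Lemma no_return i d :
  W i = r -> 0 < d -> (forall e, 0 < e <= d -> W (i + e) <> l) -> W (i + d) <> r.
Proof.
move=> ir d0 no_l idr.
have never m : W m = r -> forall m', m' <= m -> W m' <> l.
  elim/ltn_ind: m => m IH mr m' m'm.
  have [short|long] := leqP d (m - m').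
    apply: (IH (m - d)); [lia| |lia].
    rewrite -ir; apply: esym; apply: (@back_steps d) => //.
    by rewrite idr -mr; congr W; lia.
  have -> : W m' = W (i + (d - (m - m'))); last by apply: no_l; lia.
  apply: esym; apply: (@back_steps (m - m')) => [|e em].
    rewrite -addnA subnK ?idr -?mr; last lia.
    by congr W; lia.
  by rewrite -addnA; apply: no_l; lia.
have [|m0 _ m0l] := @recurs l 0; first by rewrite rev_lang.
have [m m0m mr] := recurs m0 rL.
exact: never mr _ m0m m0l.
Qed.

(** A path of the graph leaving r and stopped at the first visit of l; its
    length is a.  When r = l it is a return path. *)
Definition excursion i a :=
  [/\ W i = r, 0 < a, W (i + a) = l & forall d, 0 < d < a -> W (i + d) <> l].

Lemma excursion_exists i : W i = r -> exists a, excursion i a.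
Proof.
move=> ir; have [|m im ml] := @recurs l i.+1; first by rewrite rev_lang.
have ex : exists a, (0 < a) && (W (i + a) == l).
  by exists (m - i); rewrite subnKC ?ml ?eqxx; lia.
case: (ex_minnP ex) => a /andP[a0 /eqP al] min; exists a; split=> // d /andP[d0 da].
by move=> dl; have := min d; rewrite d0 dl eqxx => /(_ isT); lia.
Qed.

Lemma excursion_not_r i a d : excursion i a -> 0 < d < a -> W (i + d) <> r.
Proof.
by case=> ir a0 _ no_l da; apply: no_return => //; [lia | move=> e ed; apply: no_l; lia].
Qed.

(** Windows before the final l are reached without passing a left special
    window, so equal ones have the same past back to the last r, that is, back
    to the start of both excursions. *)
Lemma excursion_meet i j a b d e :
  excursion i a -> excursion j b -> d < a -> e < b -> W (i + d) = W (j + e) ->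
  d = e /\ (0 < d -> u (i + n) = u (j + n)).
Proof.
wlog de : i j a b d e / d <= e.
  move=> H xi xj da eb E; have [de|/ltnW ed] := leqP d e; first exact: H xi xj da eb E.
  have [<- H1] := H j i b a e d ed xj xi eb da (esym E); split=> // /H1; exact: esym.
move=> xi xj da eb E; have [ir _ _ no_l] := xi.
have jE : W i = W (j + (e - d)).
  apply: (@back_steps d) => [|k kd]; last by apply: no_l; lia.
  by rewrite E -addnA subnK.
have {}de : d = e.
  have [//|ne] := eqVneq d e.
  case: (@excursion_not_r _ _ (e - d) xj); first lia.
  by rewrite -jE.
split=> // d0; have /eqP/window_eqP : W i.+1 = W j.+1.
  apply: (@back_steps d.-1) => [|k kd].
    by rewrite !addSnnS prednK // E de.
  by rewrite addSnnS; apply: no_l; lia.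
by move=> /(_ n.-1); rewrite !addSnnS prednK //; apply.
Qed.

(** After the first letter the path does not branch until it has reached l,
    because r does not reappear. *)
Lemma excursion_eq i j a b :
  excursion i a -> excursion j b -> u (i + n) = u (j + n) ->
  a = b /\ forall d, d <= a -> W (i + d) = W (j + d).
Proof.
move=> xi xj E; have [ir a0 al no_l] := xi; have [jr b0 bl no_l'] := xj.
have same d : d <= a -> d <= b -> W (i + d) = W (j + d).
  elim: d => [|d IH] da db; first by rewrite !addn0 ir jr.
  rewrite !addnS; apply: window_shift; first by apply: IH; lia.
  have [->|d0] := posnP d; first by rewrite !addn0.
  by apply: step_forward; [apply: IH; lia | apply: excursion_not_r xi _; lia].
have ab : a = b.
  have [lt|gt|//] := ltngtP a b.
    by case: (no_l' a); [lia | rewrite -same ?al //; lia].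
  by case: (no_l b); [lia | rewrite same ?bl //; lia].
by split=> // d da; apply: same; rewrite -?ab.
Qed.

(** Reversal exchanges r and l, and the absence of r inside an excursion makes
    the final l of the reversed path its first one. *)
Lemma excursion_rev i a : excursion i a ->
  exists2 i', excursion i' a & forall d, d <= a -> W (i' + d) = rev_tup (W (i + (a - d))).
Proof.
move=> xi; have [ir a0 al no_l] := xi.
have := window_lang u (a + n) i; rewrite -(rev_lang rcu) => /langP[i' Ei'].
have {}Ei' d : d <= a -> W (i' + d) = rev_tup (W (i + (a - d))).
  move=> da; apply/eqP/window_revP => k kn.
  move/esym/eqP/window_revP: Ei' => /(_ (d + k)); rewrite addnA => ->; last lia.
  by congr u; lia.
exists i' => //; split=> //.
- by rewrite -[i']addn0 Ei' // subn0 al rev_tupK.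
- by rewrite Ei' // subnn addn0 ir.
- move=> d da; rewrite Ei'; last lia.
  move=> /(can_inj (@rev_tupK A n)); apply: (excursion_not_r xi); lia.
Qed.

(** If the length a of the two paths is at most n, the letters that follow r are
    still visible in the common final window l, so they agree; if a = n + 1 the
    letter following r is the one preceding l, which the swap gives the other
    path as letter following r.  So a > n + 1, and the first n + 1 windows after
    r on the two paths are 2n + 2 distinct factors. *)
Lemma swapped_excursions i j a :
  excursion i a -> excursion j a -> u (i + n) <> u (j + n) ->
  (forall d, d <= a -> W (j + d) = rev_tup (W (i + (a - d)))) ->
  2 * n + 2 <= factor_complexity u n.
Proof.
move=> xi xj ne sw; have [ir a0 al no_l] := xi; have [jr _ bl no_l'] := xj.
have long : n.+1 < a.
  rewrite ltnNge; apply/negP => short; apply: ne.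
  have [an|na] := leqP a n.
    have /eqP/window_eqP/(_ (n - a)) : W (i + a) = W (j + a) by rewrite al bl.
    by rewrite -!addnA subnKC //; apply; lia.
  have /eqP/window_revP/(_ 0 n_gt0) := sw n (ltnW na).
  rewrite addn0 => ->; congr u; lia.
pose g (x : bool * 'I_n.+1) := W ((if x.1 then i else j) + x.2.+1).
have g_inj : injective g.
  move=> [[] x] [[] y]; rewrite /g /= => E; have := ltn_ord x; have := ltn_ord y => yn xn.
  - have [||[xy] _] := excursion_meet xi xi _ _ E; [lia|lia|].
    by congr pair; apply: val_inj.
  - have [||[xy] ] := excursion_meet xi xj _ _ E; [lia|lia|].
    by move=> /(_ isT) /ne.
  - have [||[xy] ] := excursion_meet xj xi _ _ E; [lia|lia|].
    by move=> /(_ isT) /esym/ne.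
  - have [||[xy] _] := excursion_meet xj xj _ _ E; [lia|lia|].
    by congr pair; apply: val_inj.
have := card_imset [set: bool * 'I_n.+1] g_inj; rewrite cardsT card_prod card_bool card_ord.
have : g @: [set: bool * 'I_n.+1] \subset lang u n.
  by apply/subsetP => _ /imsetP[x _ ->]; apply: window_lang.
by move=> /subset_leq_card; rewrite -/(factor_complexity u n) => + E; rewrite E; lia.
Qed.

(** The middle of a path fixed by reversal is a vertex or an edge, according to
    the parity of its length.  A central vertex lies strictly inside the path. *)
Lemma symmetric_excursion_centre i a :
  excursion i a -> (forall d, d <= a -> W (i + d) = rev_tup (W (i + (a - d)))) ->
  (exists h, [/\ 0 < h, h < a & rev_tup (W (i + h)) = W (i + h)]) \/
  (exists h, h < a /\ rev_tup (window u n.+1 (i + h)) = window u n.+1 (i + h)).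
Proof.
move=> [_ a0 _ _] sym; have := odd_double_half a; case: (odd a) => /= aE.
  right; exists a./2; split; first lia.
  apply/esym/eqP/window_revP => k kn.
  have /eqP/window_revP H := sym a./2 ltac:(lia).
  have [kn'|kn'] := ltnP k n; first by rewrite H //; congr u; lia.
  have /eqP/window_revP/(_ n.-1) := sym a./2.+1 ltac:(lia).
  have -> : i + a./2.+1 + n.-1 = i + a./2 + k by lia.
  by move=> ->; [congr u; lia|lia].
left; exists a./2; split; [lia|lia|].
by apply/esym; rewrite {1}sym; [congr (rev_tup (W _)); lia|lia].
Qed.

(** The reversal of each of the two excursions is one of the two. *)
Lemma single_branch_dichotomy :
  1 < palindromic_complexity u n + palindromic_complexity u n.+1 \/
  2 * n + 2 <= factor_complexity u n.
Proof.
have /card_gt1P[a [b [ar br /eqP ab]]] : 1 < #|rext u r| by rewrite r2.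
have [k _ kr] := recurs 0 rL.
move: (ar) (br); rewrite -{1 2}kr => /mem_rext_window[i + ia] /mem_rext_window[j + jb].
rewrite kr => ir jr; rewrite -ia -jb in ab ar br.
(* The letters following r at i and at j are its only two extensions. *)
have alt m : W m = r -> u (m + n) <> u (i + n) -> u (m + n) = u (j + n).
  move=> mr mi; have mx : u (m + n) \in rext u r.
    by rewrite -mr; apply/mem_rext_window; exists m.
  apply: contrapT => mj; have : 2 < #|rext u r|; last by rewrite r2.
  apply/card_gt2P; exists (u (i + n)), (u (j + n)), (u (m + n));
  by split; [split | split; [exact/eqP|exact/eqP/nesym|exact/eqP]].
have [p xi] := excursion_exists ir; have [q xj] := excursion_exists jr.
have [i' xi' Ei'] := excursion_rev xi; have [j' xj' Ej'] := excursion_rev xj.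
have [i'i|i'i] := pselect (u (i' + n) = u (i + n)); last first.
  right; have [ir' _ _ _] := xi'.
  have [pq Eq] := excursion_eq xi' xj (alt _ ir' i'i); subst q.
  apply: swapped_excursions xi xj ab _ => d dp; rewrite -Ei' ?Eq //.
have [j'i|j'i] := pselect (u (j' + n) = u (i + n)).
  right; have [qp Eq] := excursion_eq xj' xi j'i; subst q.
  by apply: swapped_excursions xj xi (nesym ab) _ => d dp; rewrite -Ej' ?Eq.
have [jr' _ _ _] := xj'; have j'j := alt _ jr' j'i.
have [_ Ei] := excursion_eq xi' xi i'i; have [_ Ej] := excursion_eq xj' xj j'j.
left.
(* Both excursions are fixed by reversal: their centres are two palindromes,
   distinct because the excursions share no window other than r and l. *)
have [|[h [h0 hp Hh]]|[h [hp Hh]]] := symmetric_excursion_centre xi.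
- by move=> d dp; rewrite -Ei' ?Ei.
- have [|[h' [h'0 h'q Hh']]|[h' [h'q Hh']]] := symmetric_excursion_centre xj.
  + by move=> d dp; rewrite -Ej' ?Ej.
  + rewrite ltn_addr //; apply: pal_complexity_gt1 Hh Hh' _ => E.
    by have [_ /(_ h0)/ab] := excursion_meet xi xj hp h'q E.
  + by have := pal_complexity_gt0 Hh; have := pal_complexity_gt0 Hh'; lia.
- have [|[h' [h'0 h'q Hh']]|[h' [h'q Hh']]] := symmetric_excursion_centre xj.
  + by move=> d dp; rewrite -Ej' ?Ej.
  + by have := pal_complexity_gt0 Hh; have := pal_complexity_gt0 Hh'; lia.
  + rewrite ltn_addl //; apply: pal_complexity_gt1 Hh Hh' _ => /eqP/window_eqP E.
    have [|hh'] := excursion_meet xi xj hp h'q.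
      by apply/eqP/window_eqP => x xn; apply: E; lia.
    have [h0 _|h0 /(_ isT)/ab //] := posnP h; have := E n (leqnn _).
    by rewrite -hh' h0 !addn0 => /ab.
Qed.

End SingleBranch.

(** * Deficit and complexity *)

Section LowComplexity.
Variables (A : finType) (u : nat -> A).
Hypotheses (rec : recurrent u) (aper : aperiodic u) (rcu : reversal_closed u).

Lemma not_deficient0 : ~ deficient u 0.
Proof.
have := complexity_gt 0 aper.
have : 0 < palindromic_complexity u 0.
  by apply: (@pal_complexity_gt0 A u 0 0); apply: val_inj.
suff : palindromic_complexity u 1 = factor_complexity u 1 by rewrite /deficient; lia.
apply: eq_card => w; rewrite !inE /palindrome; case/tupleP: w => a w.
by apply: andb_idr => _; rewrite (tuple0 w); apply/eqP.
Qed.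

(** P(n) + P(n+1) has the parity of p(n) + p(n+1), which is odd here, and it is
    less than 3; so it is at most 1, and the two excursions are swapped. *)
Lemma flat_deficient_complexity n :
  deficient u n -> factor_complexity u n.+1 = factor_complexity u n + 1 ->
  2 * n + 2 <= factor_complexity u n.
Proof.
move=> dn flat; have n0 : 0 < n by case: n dn {flat} => // /not_deficient0.
have [r rL r2] := right_special_exists n aper.
have single (w : n.-tuple A) : w \in lang u n -> w != r -> #|rext u w| <= 1.
  move=> wL wr; rewrite leqNgt; apply/negP => w2.
  by have := complexity_growth2 wL rL wr w2 r2; lia.
have {}r2 : #|rext u r| = 2 by have := complexity_growth rL; lia.
have [|//] := single_branch_dichotomy rcu rec n0 rL r2 single.
have [a [b [ab _]]] := complexity_parity rcu n.
have [a' [b' [_ ab']]] := complexity_parity rcu n.+1.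
move: dn; rewrite /deficient; lia.
Qed.

Lemma deficient_complexity n : deficient u n -> 3 * n + 3 <= 2 * factor_complexity u n.
Proof.
elim: n => [/not_deficient0//|n IH] dn1.
have [dn|ndn] := pselect (deficient u n); last first.
  have := @new_deficit_complexity _ u rcu aper n.
  by move: ndn dn1; rewrite /deficient; lia.
have := complexity_increasing n aper; have := IH dn.
have [E|] := eqVneq (factor_complexity u n.+1) (factor_complexity u n + 1); last lia.
have := flat_deficient_complexity dn E; lia.
Qed.

End LowComplexity.

(** * Strong bispecial factors *)

Section StrongBispecial.
Variables (A : finType) (u : nat -> A).
Hypothesis rcu : reversal_closed u.

(** For two letters x, x' of X and two letters y, y' of Y, the edges xwy, xwy',
    x'wy' and x'wy form a cycle through the vertices xw, wy', x'w and wy.  The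
    edge xwy visited last among those given by X and Y leads to a vertex that
    a neighbouring edge has already visited. *)
Lemma strong_bispecial_deficient n (w : n.-tuple A) (X Y : {set A}) :
  rev_tup w != w -> 1 < #|X| -> 1 < #|Y| -> setX X Y \subset biext u w ->
  deficient u n.+1.
Proof.
move=> wP X2 Y2 XY.
(* t p is the time of the first visit of the edge p, up to reversal. *)
pose at_time i (p : A * A) :=
  (window u n.+2 i == around (w, p)) || (window u n.+2 i == rev_tup (around (w, p))).
have /fin_all_exists[t Ht] (p : A * A) :
    exists i, p \in setX X Y -> at_time i p /\ forall j, at_time j p -> i <= j.
  have [pXY|] := boolP (p \in setX X Y); last by exists 0.
  have ex : exists i, at_time i p.
    have : around (w, p) \in lang u n.+2.
      by move/(subsetP XY): pXY; rewrite !inE; case: p.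
    by case/langP => i E; exists i; rewrite /at_time -E eqxx.
  by case: (ex_minnP ex) => i ip min; exists i.
have t_inj p p' : p \in setX X Y -> p' \in setX X Y -> t p = t p' -> p = p'.
  move=> /Ht[tp _] /Ht[tp' _] E; rewrite E in tp; move: tp tp'.
  rewrite /at_time => /orP[]/eqP-> /orP[]/eqP.
  - by move/around_inj => [].
  - case: p' {E} => a b; rewrite rev_around => /around_inj[/esym/eqP].
    by rewrite (negbTE wP).
  - by case: p {E} => a b; rewrite rev_around => /around_inj[/eqP]; rewrite (negbTE wP).
  - by move/(can_inj (@rev_tupK _ _))/around_inj => [].
have other (Z : {set A}) z : 1 < #|Z| -> exists2 z', z' \in Z & z' != z.
  move=> Z2; have /card_gt0P[z'] : 0 < #|Z :\ z|.
    by have := cardsD1 z Z; case: (z \in Z); lia.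
  by rewrite in_setD1 => /andP[? ?]; exists z'.
have [x0 x0X] : exists x, x \in X by apply/card_gt0P; apply: ltnW.
have [y0 y0Y] : exists y, y \in Y by apply/card_gt0P; apply: ltnW.
have p0 : (x0, y0) \in setX X Y by rewrite in_setX x0X.
case: (arg_maxnP t p0) => -[x y] pXY tmax.
have /andP[xX yY] : (x \in X) && (y \in Y) by rewrite -in_setX.
have earlier p : p \in setX X Y -> p != (x, y) -> at_time (t p) p /\ t p < t (x, y).
  move=> pQ ne; split; first by case: (Ht _ pQ).
  rewrite ltn_neqAle [_ <= _](tmax p pQ) andbT.
  by apply: contra ne => /eqP/(t_inj _ _ pQ pXY) ->.
have [x' x'X x'x] := other X x X2; have [y' y'Y y'y] := other Y y Y2.
have [ex' lx'] : at_time (t (x', y)) (x', y) /\ t (x', y) < t (x, y).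
  by apply: earlier; rewrite ?in_setX ?x'X // xpair_eqE negb_and x'x.
have [ey' ly'] : at_time (t (x, y')) (x, y') /\ t (x, y') < t (x, y).
  by apply: earlier; rewrite ?in_setX ?xX // xpair_eqE negb_and y'y orbT.
have [now first] := Ht _ pXY.
suff [f1 f2 f3] : [/\ fresh (window u n.+2) (@rev_tup A n.+2) (t (x, y)),
    rev_tup (window u n.+2 (t (x, y))) != window u n.+2 (t (x, y))
    & ~~ fresh (window u n.+1) (@rev_tup A n.+1) (t (x, y)).+1].
  by rewrite /deficient addn2 ltnS; apply: leqW (deficit_gt0 rcu f1 f2 f3).
have nonpal : rev_tup (around (w, (x, y))) != around (w, (x, y)).
  by rewrite rev_around; apply: contra wP => /eqP/around_inj[->].
split.
- apply/freshP => j jt; have /negP/norP[/eqP n1 /eqP n2] : ~ at_time j (x, y).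
    by move/first; rewrite leqNgt jt.
  by case/orP: now => /eqP ->; rewrite ?rev_tupK.
- by case/orP: now => /eqP ->; rewrite ?rev_tupK // eq_sym.
apply/negP => /freshP fr; case/orP: now => /eqP E.
  have [_ Es] := window_around E.
  case/orP: ex' => /eqP E'.
    have [_ Es'] := window_around E'.
    by have [|[]] := fr (t (x', y)).+1; [|rewrite Es'].
  rewrite rev_around in E'; have [Es' _] := window_around E'.
  have [|_ []] := fr (t (x', y)); first exact: leqW.
  by rewrite Es Es'; apply: val_inj; rewrite /= rev_rcons.
rewrite rev_around in E; have [_ Es] := window_around E.
case/orP: ey' => /eqP E'.
  have [Es' _] := window_around E'.
  have [|_ []] := fr (t (x, y')); first exact: leqW.
  by rewrite Es Es'; apply: val_inj; rewrite /= rev_rcons revK.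
rewrite rev_around in E'; have [_ Es'] := window_around E'.
by have [|[]] := fr (t (x, y')).+1; [|rewrite Es'].
Qed.

End StrongBispecial.

(** * Recurrence, reversal and periods from shifts and mirrors *)

Section Repetition.
Variables (A : finType) (u : nat -> A).

(** An occurrence inside the prefix of length N recurs along an arithmetic
    progression of difference P, which bounds the gaps as well. *)
Lemma uniformly_recurrent_of_shifts :
  (forall N, exists2 P, 0 < P & forall m j, m < N -> u (m + j * P) = u m) ->
  uniformly_recurrent u.
Proof.
move=> H; have shift w i : occurs_at u w i ->
    exists2 P, 0 < P & forall j, occurs_at u w (i + j * P).
  move=> /(occursP u) wi; have [P P0 HP] := H (i + size w); exists P => // j.
  apply/(occursP u) => k kw; rewrite wi // addnAC HP //; lia.
split=> [w [i /shift[P P0 HP]] N|w [i /shift[P P0 HP]]].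
  by exists (i + N * P); split=> //; nia.
(* The progression starts at i; a gap beginning before i costs at most i. *)
exists (i + P) => j k [jk _ _ none]; rewrite leqNgt; apply/negP => far.
pose d := (j - i) %/ P; have := divn_eq (j - i) P; have := ltn_pmod (j - i) P0.
rewrite -/d => r1 r2; apply: (none (i + d.+1 * P)) => //.
rewrite mulSn; have [ij|ji] := leqP i j; first lia.
have d0 : d = 0 by rewrite /d (_ : j - i = 0) ?div0n //; lia.
rewrite d0; lia.
Qed.

Lemma reversal_closed_of_pal_prefixes :
  (forall N, exists2 L, N <= L & forall m, m < L -> u (L - m.+1) = u m) ->
  reversal_closed u.
Proof.
move=> H w [i /(occursP u) wi]; have [L NL HL] := H (i + size w).
exists (L - (i + size w)); apply/(occursP u) => k; rewrite size_rev => kw.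
rewrite nth_rev // wi; last lia.
rewrite -HL; last lia.
by congr u; lia.
Qed.

Lemma eventually_periodic_shift :
  eventually_periodic u -> exists N q, 0 < q /\ forall m, N <= m -> u (m + q) = u m.
Proof.
move=> [x [y [y0 H]]]; exists (size x), (size y); split; first by case: y y0 {H}.
move=> m xm; rewrite (H m) (H (m + _)) !ltnNge xm (leq_trans xm (leq_addr _ _)) /=.
by rewrite -addnBAC // modnDr.
Qed.

End Repetition.

(** * Period doubling *)

(** The period doubling word: the parity of the exponent of 2 in q + 1. *)
Definition toggle (q : nat) : bool := odd (logn 2 q.+1).

Lemma logn2_odd e x : odd x -> logn 2 (2 ^ e * x) = e.
Proof.
move=> ox; rewrite lognM ?expn_gt0 ?(odd_gt0 ox) // (pfactorK e (isT : prime 2)).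
by rewrite logn_coprime ?addn0 // coprime2n.
Qed.

Lemma odd_part x : 0 < x -> exists e o, odd o /\ x = 2 ^ e * o.
Proof.
move=> x0; have [o] := @pfactor_coprime 2 x isT x0.
by rewrite coprime2n => oo ->; exists (logn 2 x), o; rewrite mulnC.
Qed.

Lemma exponent_lt e o k : odd o -> 2 ^ e * o < 2 ^ k -> e < k.
Proof.
move=> oo lt; rewrite ltnNge; apply/negP => /(leq_pexp2l (isT : 0 < 2)).
rewrite leqNgt => /negP; apply; apply: leq_ltn_trans lt.
by rewrite leq_pmulr // odd_gt0.
Qed.

(** Adding a multiple of 2^k to a smaller positive number keeps its exponent
    of 2. *)
Lemma toggle_shift q k m : q.+1 < 2 ^ k -> toggle (q + m * 2 ^ k) = toggle q.
Proof.
have [e [o [oo E]]] := odd_part (ltn0Sn q); rewrite /toggle -addSn E => lt.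
have ek := exponent_lt oo lt; rewrite -(subnKC ek) expnD expnS.
rewrite (_ : _ + _ = 2 ^ e * (o + 2 * (m * 2 ^ (k - e.+1)))); last by ring.
by rewrite !logn2_odd // oddD oo oddM.
Qed.

(** Subtracting a smaller positive number from 2^k keeps its exponent of 2;
    so the prefix of length 2^k - 1 is a palindrome. *)
Lemma toggle_mirror q k : q.+1 < 2 ^ k -> toggle (2 ^ k - q.+2) = toggle q.
Proof.
move=> lt; rewrite /toggle -subSn // subSS.
have [e [o [oo E]]] := odd_part (ltn0Sn q); rewrite E in lt *.
have ek := exponent_lt oo lt; rewrite -{1}(subnKC ek) expnD expnSr -mulnA -mulnBr.
rewrite -(subnKC ek) expnD expnSr -mulnA ltn_pmul2l ?expn_gt0 // in lt.
by rewrite !logn2_odd // oddB ?oddM ?oo // ltnW.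
Qed.

(** Write q = 2^e o with o odd.  Adding q to an odd multiple of 2^(e+1) lowers
    the exponent of 2 from e + 1 to e. *)
Lemma toggle_not_periodic q N :
  0 < q -> exists2 a, N <= a & toggle (a + q) != toggle a.
Proof.
move=> q0; have [e [o [oo ->]]] := odd_part q0.
have e0 : 0 < 2 ^ e by rewrite expn_gt0.
exists (2 ^ e * (4 * N + 2)).-1; first nia.
have pos : 0 < 2 ^ e * (4 * N + 2) by nia.
rewrite /toggle -addSn prednK // -mulnDr logn2_odd; last by rewrite oddD oo oddD oddM.
have -> : 2 ^ e * (4 * N + 2) = 2 ^ e.+1 * (2 * N + 1) by rewrite expnS; ring.
by rewrite logn2_odd; [rewrite /=; case: (odd e) | rewrite oddD oddM].
Qed.

(** * The extremal words *)

Section Example.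
Variable h : nat.

Definition period := 8 * h + 8.

(** The positions of the ones.  The runs of zeros inside the two blocks have
    lengths 2h+1, 2h+2, 2h+1 for false and 2h+2, 2h, 2h+2 for true; the h zeros
    at both ends make a run of length 2h between any two blocks.  Both blocks
    are palindromes of the same length. *)
Definition block (c : bool) (s : nat) : bool :=
  if c then s \in [:: h; 3 * h + 3; 5 * h + 4; 7 * h + 7]
  else s \in [:: h; 3 * h + 2; 5 * h + 5; 7 * h + 7].

Definition example (m : nat) : bool :=
  block (toggle (m %/ period)) (m %% period).

Lemma period_gt0 : 0 < period.
Proof. rewrite /period; lia. Qed.

Lemma exampleE q s : s < period -> example (q * period + s) = block (toggle q) s.
Proof.
move=> sp; rewrite /example divnMDl ?period_gt0 // divn_small // addn0.
by rewrite modnMDl modn_small.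
Qed.

Lemma position m : exists q s, s < period /\ m = q * period + s.
Proof.
by exists (m %/ period), (m %% period); rewrite ltn_mod period_gt0 -divn_eq.
Qed.

Lemma block_mirror c s : s < period -> block c (period - s.+1) = block c s.
Proof.
rewrite /period => sp; rewrite /block; case: c; rewrite !inE; lia.
Qed.

Lemma example_shift k m j : m < (2 ^ k).-1 * period ->
  example (m + j * (2 ^ k * period)) = example m.
Proof.
have [q [s [sp ->]]] := position m => lt.
have qk : q.+1 < 2 ^ k.
  have : q < (2 ^ k).-1
    by rewrite -(ltn_pmul2r period_gt0); apply: leq_ltn_trans lt; rewrite leq_addr.
  lia.
rewrite addnAC mulnA -mulnDl !exampleE // toggle_shift //.
Qed.

Lemma example_mirror k m : m < (2 ^ k).-1 * period ->
  example ((2 ^ k).-1 * period - m.+1) = example m.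
Proof.
have [q [s [sp ->]]] := position m => lt.
have qk : q < (2 ^ k).-1.
  by rewrite -(ltn_pmul2r period_gt0); apply: leq_ltn_trans lt; rewrite leq_addr.
have -> : (2 ^ k).-1 * period - (q * period + s).+1
    = (2 ^ k - q.+2) * period + (period - s.+1).
  have -> : (2 ^ k).-1 = (2 ^ k - q.+2) + q.+1 by lia.
  rewrite mulnDl mulSn; lia.
rewrite !exampleE ?toggle_mirror ?block_mirror //; first lia.
by have := period_gt0; lia.
Qed.

Lemma prefix_exists N : exists k, N <= (2 ^ k).-1 * period.
Proof.
exists N; apply: leq_trans (leq_pmulr _ period_gt0).
by rewrite -ltnS prednK ?expn_gt0 // ltn_expl.
Qed.

Lemma example_uniformly_recurrent : uniformly_recurrent example.
Proof.
apply: uniformly_recurrent_of_shifts => N; have [k Nk] := prefix_exists N.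
exists (2 ^ k * period); first by rewrite muln_gt0 expn_gt0 period_gt0.
by move=> m j mN; apply: example_shift; apply: leq_trans Nk.
Qed.

Lemma example_reversal_closed : reversal_closed example.
Proof.
apply: reversal_closed_of_pal_prefixes => N; have [k Nk] := prefix_exists N.
by exists ((2 ^ k).-1 * period) => // m; apply: example_mirror.
Qed.

Lemma example_aperiodic : aperiodic example.
Proof.
move=> /eventually_periodic_shift[N [q [q0 H]]].
have [a Na] := toggle_not_periodic N q0; case/eqP.
have tE b : toggle b = example (b * period + (3 * h + 3)).
  rewrite exampleE; last by rewrite /period; lia.
  rewrite /block !inE; case: (toggle b); lia.
rewrite !tE mulnDl addnAC [q * _]mulnC (shift_multiples _ H) //.
by have := leq_pmulr a period_gt0; lia.
Qed.

(** Successive ones are 2h+1, 2h+2 or 2h+3 apart, and two consecutive gaps are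
    never both 2h+1, so a window of length 4h+3 does not reach a third one. *)
Lemma two_marks m : exists i j : nat, [/\ i < 2 * h + 3, j < 3 &
  forall k, k < 4 * h + 3 -> example (m + k) = (k == i) || (k == i + (2 * h + 1) + j)].
Proof.
have [q [s [sp ->]]] := position m.
have read k : k < 4 * h + 3 -> example (q * period + s + k)
    = if s + k < period then block (toggle q) (s + k)
      else block (toggle q.+1) (s + k - period).
  move=> kh; case: ltnP => sk; first by rewrite -addnA exampleE.
  rewrite -exampleE; last by move: sp; rewrite /period; lia.
  by congr example; rewrite mulSn; lia.
suff [i [j [ih j3 H]]] : exists i j : nat,
    [/\ i < 2 * h + 3, j < 3 & forall k, k < 4 * h + 3 ->
    (if s + k < period then block (toggle q) (s + k)
      else block (toggle q.+1) (s + k - period))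
      = (k == i) || (k == i + (2 * h + 1) + j)].
  by exists i, j; split=> // k kh; rewrite read // H.
move: sp {read} (toggle q) (toggle q.+1); rewrite /period /block => sp c c'.
(* The cases locate s among the four ones of its block; j + 2h + 1 is the gap
   between the first two ones that follow. *)
have [s1|s1] := leqP s h.
  by case: c; [exists (h - s), 2 | exists (h - s), 1]; split=> [||k kh]; try lia;
    case: ifP => ?; case: c'; rewrite !inE; lia.
have [s2|s2] := leqP s (if c then 3 * h + 3 else 3 * h + 2).
  by case: c s2 => s2; [exists (3 * h + 3 - s), 0 | exists (3 * h + 2 - s), 2];
    split=> [||k kh]; try lia; case: ifP => ?; case: c'; rewrite !inE; lia.
have [s3|s3] := leqP s (if c then 5 * h + 4 else 5 * h + 5).
  by case: c s2 s3 => s2 s3; [exists (5 * h + 4 - s), 2 | exists (5 * h + 5 - s), 1];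
    split=> [||k kh]; try lia; case: ifP => ?; case: c'; rewrite !inE; lia.
have [s4|s4] := leqP s (7 * h + 7).
  by exists (7 * h + 7 - s), 0; case: c s3 {s2} => s3;
    split=> [||k kh]; try lia; case: ifP => ?; case: c'; rewrite !inE; lia.
by case: c'; [exists (9 * h + 8 - s), 2 | exists (9 * h + 8 - s), 1];
  split=> [||k kh]; try lia; case: ifP => ?; case: c s2 s3 => *; rewrite !inE; lia.
Qed.

Lemma example_complexity : factor_complexity example (4 * h + 3) <= 6 * h + 9.
Proof.
pose mark (p : 'I_(2 * h + 3) * 'I_3) :=
  [tuple (k == p.1 :> nat) || (k == p.1 + (2 * h + 1) + p.2 :> nat) | k < 4 * h + 3].
have sub : lang example (4 * h + 3) \subset [set mark p | p : 'I_(2 * h + 3) * 'I_3].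
  apply/subsetP => _ /langP[m ->]; have [i [j [ih j3 H]]] := two_marks m.
  apply/imsetP; exists (Ordinal ih, Ordinal j3) => //.
  apply: eq_from_tnth => k; rewrite tnth_mktuple (tnth_nth (example 0)).
  by rewrite nth_window // H.
apply: leq_trans (subset_leq_card sub) _; apply: leq_trans (leq_imset_card _ _) _.
by rewrite card_prod !card_ord; lia.
Qed.

Lemma example_start s : s < 2 * period -> example s =
  if s < period then block false s else block true (s - period).
Proof.
move=> s2; case: ltnP => sp; first exact: (@exampleE 0).
by rewrite -{1}(subnKC sp) -[X in X + _]mul1n (@exampleE 1) //; lia.
Qed.

(** The four extensions of w = 0^(2h+1) 1 0^(2h) are found in the first two
    blocks: 1w1 across their boundary, 1w0 and 0w0 inside the first, 0w1 inside
    the second. *)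
Lemma example_deficient : deficient example (4 * h + 3).
Proof.
pose n := 4 * h + 2; have -> : 4 * h + 3 = n.+1 by rewrite /n; lia.
have start := example_start.
pose w := window example n h.+1.
have wE k : k < n -> nth false w k = (k == 2 * h + 1).
  rewrite /n => kn; rewrite /w nth_mkseq // start; last by rewrite /period; lia.
  rewrite /block !inE /period; case: ifP; lia.
have same i : i + n < 2 * period ->
    (forall k, k < n -> example (i + k) = (k == 2 * h + 1)) ->
    window example n i = w.
  move=> i2 H; apply/eqP/window_eqP => k kn; rewrite H // -wE //.
  by rewrite /w nth_mkseq.
have occ i a b : i.+1 + n < 2 * period -> example i = a -> example (i.+1 + n) = b ->
    (forall k, k < n -> example (i.+1 + k) = (k == 2 * h + 1)) ->
    (a, b) \in biext example w.
  by move=> i2 <- <- H; rewrite -(same i.+1) //; apply: biext_window.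
apply: (@strong_bispecial_deficient _ _ example_reversal_closed n w setT setT).
- apply/eqP => /(congr1 (fun t : n.-tuple bool => nth false t (2 * h))).
  rewrite nth_rev size_tuple; last by rewrite /n; lia.
  by rewrite !wE /n; lia.
- by rewrite cardsT card_bool.
- by rewrite cardsT card_bool.
apply/subsetP => -[a b] _.
suff [i i2 H] : exists2 i, i.+1 + n < 2 * period & [/\ example i = a,
    example (i.+1 + n) = b & forall k, k < n -> example (i.+1 + k) = (k == 2 * h + 1)].
  by case: H => ia ib H; apply: (occ i).
move: start {same occ w wE}; rewrite /n /period /block => start.
case: a; case: b;
  [exists (5 * h + 5)|exists h|exists (9 * h + 9)|exists (3 * h + 3)]; try lia;
  split=> [| |k kn]; rewrite start; try lia; case: ifP; rewrite !inE; lia.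
Qed.

End Example.

Local Open Scope ring_scope.

Theorem theorem1p1 (R : realType) :
  (forall (A : finType) (u : nat -> A),
     recurrent u -> aperiodic u -> reversal_closed u ->
     forall n : nat,
       (factor_complexity u n)%:R <= 3 / 2 * n%:R + 1 :> R ->
       (palindromic_complexity u n)%:Z + (palindromic_complexity u n.+1)%:Z
       = (factor_complexity u n.+1)%:Z - (factor_complexity u n)%:Z + 2)
  /\
  (forall c : R, 3 / 2 < c ->
     exists (n : nat) (v : nat -> bool),
       [/\ uniformly_recurrent v, aperiodic v, reversal_closed v,
           (factor_complexity v n)%:R <= c * n%:R + 1
         & (palindromic_complexity v n)%:Z + (palindromic_complexity v n.+1)%:Z
           < (factor_complexity v n.+1)%:Z - (factor_complexity v n)%:Z + 2]).
Proof.
split=> [A u rec aper rcu n low | c c32].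
  have {}low : (2 * factor_complexity u n <= 3 * n + 2)%N.
    by rewrite -(ler_nat R) natrD !natrM; lra.
  have := @deficient_complexity A u rec aper rcu n.
  by have := deficit_ge0 rcu n; rewrite /deficient; lia.
(* The bound 6h + 9 <= c(4h + 3) + 1 holds as soon as (c - 3/2) h > 1. *)
pose e := c - 3 / 2; have e0 : 0 < e by rewrite subr_gt0.
pose h := Num.bound e^-1; have eh : 1 < h%:R * e.
  rewrite -ltr_pdivrMr // div1r; apply: archi_boundP; rewrite invr_ge0; exact: ltW.
exists (4 * h + 3)%N, (example h); split.
- exact: example_uniformly_recurrent.
- exact: example_aperiodic.
- exact: example_reversal_closed.
- have := example_complexity h; rewrite -(ler_nat R) !natrD !natrM => low.
  by apply: le_trans low _; rewrite /e in eh e0; nra.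
- by have := example_deficient h; rewrite /deficient; lia.
Qed.
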